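(* Let $R$ be a multiplicative hyperring. If $I$ is an $n$-hyperideal of $R$, then $I$ is a $J$-prime hyperideal of $R$.
   Context: A multiplicative hyperring is a nonempty set $R$ with an operation $+$ and a hyperoperation $\circ: R\times R\to P^*(R)$ (where $P^*(R)$ is the set of nonempty subsets of $R$) such that: $(R,+)$ is an abelian group; $\circ$ is associative; $a\circ(b+c)\subseteq a\circ b+a\circ c$ and $(b+c)\circ a\subseteq b\circ a+c\circ a$; and $a\circ(-b)=(-a)\circ b=-(a\circ b)$ for all $a,b,c\in R$. For nonempty subsets $A,B\subseteq R$, $A\circ B=\bigcup_{x\in A,\,y\in B}x\circ y$, and $A\circ r=A\circ\{r\}$. Standing assumptions: $R$ is commutative with an identity $1$, meaning $a\in a\circ 1$ for all $a\in R$. A hyperideal of $R$ is a nonempty subset $I\subseteq R$ with $a-b\in I$ for $a,b\in I$ and $r\circ x\subseteq I$ for $x\in I$, $r\in R$. Let $\mathbf{C}=\{r_1\circ r_2\circ\cdots\circ r_n : r_i\in R,\ n\in\mathbb{N}\}$; a hyperideal $I$ is a $\mathbf{C}$-hyperideal if for every $A\in\mathbf{C}$, $A\cap I\neq\varnothing$ implies $A\subseteq I$. Standing assumption: all hyperideals are $\mathbf{C}$-hyperideals. A proper hyperideal $M$ is maximal if every hyperideal $N$ with $M\subsetneq N\subseteq R$ equals $R$; the Jacobson radical $J(R)$ is the intersection of all maximal hyperideals of $R$. A proper hyperideal $P$ is prime if $x\circ y\subseteq P$ with $x,y\in R$ implies $x\in P$ or $y\in P$. $\sqrt{I}$ is the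 intersection of all prime hyperideals of $R$ containing $I$ (and $\sqrt{I}=R$ if there are none); $\sqrt{0}$ is the intersection of all prime hyperideals containing $0$. A proper hyperideal $I$ is an $n$-hyperideal if for all $x,y\in R$, $x\circ y\subseteq I$ implies $x\in\sqrt{0}$ or $y\in I$. A proper hyperideal $I$ is $J$-prime if for all $x,y\in R$, $x\circ y\subseteq I$ implies $x\in J(R)$ or $y\in I$. *)

(* Defs.v *)
From HB Require Import structures.
From mathcomp Require Import all_boot all_order all_algebra.
From mathcomp Require Import all_classical.

Set Implicit Arguments.
Unset Strict Implicit.
Unset Printing Implicit Defensive.

Import GRing.Theory.
Local Open Scope ring_scope.
Local Open Scope classical_set_scope.

Definition lift_hop (T : Type) (op : T -> T -> set T) (A B : set T) : set T :=
  \bigcup_(x in A) \bigcup_(y in B) op x y.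

Definition set_add (V : zmodType) (A B : set V) : set V :=
  [set x + y | x in A & y in B].

Definition set_opp (V : zmodType) (A : set V) : set V := [set - x | x in A].

HB.mixin Record Zmodule_isMultHyperring R of GRing.Zmodule R := {
  hmul : R -> R -> set R;
  hmul_nonempty : forall a b, hmul a b !=set0;
  hmulA : forall a b c,
    lift_hop hmul [set a] (hmul b c) = lift_hop hmul (hmul a b) [set c];
  hmulDr_sub : forall a b c,
    hmul a (b + c) `<=` set_add (hmul a b) (hmul a c);
  hmulDl_sub : forall a b c,
    hmul (b + c) a `<=` set_add (hmul b a) (hmul c a);
  hmulrN : forall a b, hmul a (- b) = set_opp (hmul a b);
  hmulNr : forall a b, hmul (- a) b = set_opp (hmul a b)
}.

#[short(type="multHyperringType")]
HB.structure Definition MultHyperring :=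
  { R of Zmodule_isMultHyperring R & GRing.Zmodule R }.

(* The identity is weak: [hmul a hone] contains [a] but need not be [[set a]],
   and [hone] need not be the only element with this property. *)
HB.mixin Record MultHyperring_isComUnital R of MultHyperring R := {
  hmulC : forall a b : R, hmul a b = hmul b a;
  hone : R;
  hmul1 : forall a : R, hmul a hone a
}.

#[short(type="comMultHyperringType")]
HB.structure Definition ComMultHyperring :=
  { R of MultHyperring_isComUnital R & MultHyperring R }.

Section Hyperideals.
Variable R : comMultHyperringType.
Implicit Types (I M N P A : set R) (x y r : R).

Definition hyperideal I : Prop :=
  [/\ I !=set0,
      forall a b, I a -> I b -> I (a - b) &
      forall r x, I x -> hmul r x `<=` I].

(* The product of the nonempty word [r :: s]; for [s = [::]] it is [[set r]]. *)
Definition hprod r (s : seq R) : set R :=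
  foldl (fun A x => lift_hop hmul A [set x]) [set r] s.

Definition finite_products : set (set R) :=
  [set A | exists r s, A = hprod r s].

Definition C_hyperideal I : Prop :=
  hyperideal I /\
  forall A, finite_products A -> A `&` I !=set0 -> A `<=` I.

Definition proper_hyperideal I : Prop := hyperideal I /\ I <> setT.

Definition maximal_hyperideal M : Prop :=
  proper_hyperideal M /\
  forall N, hyperideal N -> M `<` N -> N = setT.

Definition jacobson : set R := \bigcap_(M in maximal_hyperideal) M.

Definition prime_hyperideal P : Prop :=
  proper_hyperideal P /\ forall x y, hmul x y `<=` P -> P x \/ P y.

(* With no prime hyperideal above [A], the empty intersection is [setT]. *)
Definition hyperradical A : set R :=
  \bigcap_(P in [set P | prime_hyperideal P /\ A `<=` P]) P.

Definition n_hyperideal I : Prop :=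
  proper_hyperideal I /\
  forall x y, hmul x y `<=` I -> hyperradical [set 0] x \/ I y.

Definition J_prime_hyperideal I : Prop :=
  proper_hyperideal I /\
  forall x y, hmul x y `<=` I -> jacobson x \/ I y.

End Hyperideals.

Arguments jacobson : clear implicits.
Arguments finite_products : clear implicits.

(* Main.v *)
Require Import Defs.
From mathcomp Require Import all_boot all_order all_algebra.
From mathcomp Require Import all_classical.

(** Every maximal hyperideal is prime, so [jacobson R] is an intersection over
    a subfamily of the primes containing [0] and hence contains the nilradical
    [hyperradical [set 0]]; the implication follows at once.

    To see that a maximal [M] is prime, suppose [hmul x y] lies in [M].  The
    usual argument would write the identity as an element of [M] plus a multiple
    of [x], but in a hyperring the multiples of [x] need not be closed under
    subtraction, since distributivity is only an inclusion.  The colon [M : y]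
    needs only that inclusion, as its members are tested by containment in [M],
    so it is a hyperideal ([hyperideal_colon]).  It contains both [M] and [x]; if
    [x] is not in [M], maximality forces it to be everything, so [hmul hone y]
    lies in [M], and [y] belongs to that set. *)

Import GRing.Theory.
Local Open Scope ring_scope.
Local Open Scope classical_set_scope.

Definition colon {R : comMultHyperringType} (I : set R) (y : R) : set R :=
  [set z | hmul z y `<=` I].

Lemma hyperideal0 (R : comMultHyperringType) (I : set R) :
  hyperideal I -> I 0.
Proof. by case=> -[a Ia] IB _; rewrite -(subrr a); exact: IB. Qed.

Lemma sub_colon (R : comMultHyperringType) (I : set R) (y : R) :
  hyperideal I -> I `<=` colon I y.
Proof. by case=> _ _ IM m Im; rewrite /colon /= hmulC; exact: IM. Qed.

(** Weak distributivity suffices: a superset of [hmul (a - b) y] lying in [I]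
    is all that closure under subtraction requires. *)
Lemma hyperideal_colon (R : comMultHyperringType) (I : set R) (y : R) :
  hyperideal I -> hyperideal (colon I y).
Proof.
move=> hI; have [_ IB IM] := hI; split.
- by exists 0; apply: sub_colon => //; exact: hyperideal0.
- move=> a b Ia Ib t /hmulDl_sub [u au [v]].
  rewrite hmulNr => -[w bw <-] <-.
  by apply: IB; [exact: Ia | exact: Ib].
- move=> r z Iz t rzt u tyu.
  have : lift_hop hmul (hmul r z) [set y] u by exists t => //; exists y.
  rewrite -hmulA => -[_ -> [w zyw]].
  by apply: IM; exact: Iz.
Qed.

(** As the identity is weak, [y] is recovered from [hmul hone y] only as one of its
    elements, which is enough because the whole set lies in [M]. *)
Lemma maximal_hyperideal_prime (R : comMultHyperringType) (M : set R) :
  maximal_hyperideal M -> prime_hyperideal M.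
Proof.
move=> [[hM properM] maxM]; split=> // x y xyM.
have [Mx | nMx] := pselect (M x); [by left | right].
have colonT : colon M y = setT.
  apply: maxM; first exact: hyperideal_colon.
  by split; [exact: sub_colon | move=> colonM; apply/nMx/colonM].
have : colon M y hone by rewrite colonT.
by apply; rewrite hmulC; exact: hmul1.
Qed.

Lemma nilradical_sub_jacobson (R : comMultHyperringType) :
  hyperradical [set (0 : R)] `<=` jacobson R.
Proof.
move=> x nilx M maxM; apply: nilx; split; first exact: maximal_hyperideal_prime.
by move=> _ ->; apply: hyperideal0; case: maxM => -[].
Qed.

Theorem theorem3p7 (R : comMultHyperringType)
    (all_C : forall N : set R, hyperideal N -> C_hyperideal N)
    (I : set R) :
  n_hyperideal I -> J_prime_hyperideal I.
Proof.
move=> [properI nI]; split=> // x y /nI [nilx | Iy]; [left | by right].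
exact: nilradical_sub_jacobson.
Qed.
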